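(* Let $h$ and $m$ be positive definite forms in a Hilbert space $\mathcal{H}$ with common form domain $\mathcal{Q}$, let $\mathbf{H}$ and $\mathbf{M}$ be the selfadjoint operators they define, and suppose that for some $\eta\ge 0$ $$|h(\phi,\psi)-m(\phi,\psi)|\le\eta\sqrt{h[\phi]\,m[\psi]}\qquad\text{for all }\phi,\psi\in\mathcal{Q}.$$ Let $0<L_1<L_2<D_1<D_2$ be such that the intervals $[L_1,L_2]$ and $[D_1,D_2]$ are contained in the resolvent sets of both $\mathbf{H}$ and $\mathbf{M}$. Set $Q=E_{\mathbf{H}}[L_2,D_1]$, $P=E_{\mathbf{M}}[L_2,D_1]$ and assume $$\Bigl[\frac{\sqrt{D_2D_1}}{D_2-D_1}+\frac{\sqrt{L_2L_1}}{L_2-L_1}\Bigr]\eta<1 .$$ Then $$\|P-Q\|\le\Bigl[\frac{\sqrt{D_2D_1}}{D_2-D_1}+\frac{\sqrt{L_2L_1}}{L_2-L_1}\Bigr]\eta .$$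
   Context: A positive definite form is a closed, densely defined symmetric sesquilinear form bounded below by a positive constant times $\|\cdot\|^2$; the operator $\mathbf{H}$ defined by $h$ is the selfadjoint operator with $\mathcal{D}(\mathbf{H}^{1/2})=\mathcal{Q}$ and $h(u,v)=(\mathbf{H}^{1/2}u,\mathbf{H}^{1/2}v)$, and similarly for $m$, $\mathbf{M}$. Notation: $h[\phi]=h(\phi,\phi)$, $m[\psi]=m(\psi,\psi)$. $E_{\mathbf{H}}[a,b]$ and $E_{\mathbf{M}}[a,b]$ denote the spectral projections of $\mathbf{H}$ and $\mathbf{M}$ for the interval $[a,b]$. $\|\cdot\|$ is the operator norm. *)

(* Defs.v *)
From HB Require Import structures.
From mathcomp Require Import all_boot all_order all_algebra.
From mathcomp Require Import sesquilinear complex.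
From mathcomp Require Import all_classical all_reals all_analysis.

Set Implicit Arguments.
Unset Strict Implicit.
Unset Printing Implicit Defensive.

Import Order.TTheory GRing.Theory Num.Theory.
Import numFieldNormedType.Exports.

Local Open Scope classical_set_scope.
Local Open Scope complex_scope.
Local Open Scope ring_scope.

Section Hilbert.
Variables (R : realType) (V : completeNormedModType R[i]).

(* With this identity [V] is a complex Hilbert space; [ip] is linear in its
   first argument and conjugate linear in its second. *)
Definition induces_norm (ip : {dot V for (@Num.conj R[i])}) : Prop :=
  forall u : V, ip u u = `|u| ^+ 2.

Variable ip : {dot V for (@Num.conj R[i])}.

Definition subspace (D : set V) : Prop :=
  D 0 /\ forall (a : R[i]) (u v : V), D u -> D v -> D (a *: u + v).

(* Norms in [V] are nonnegative elements of [R[i]], hence the real part. *)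
Definition opnorm (T : V -> V) : \bar R :=
  ereal_sup [set (complex.Re `|T u|)%:E | u in [set u : V | `|u| <= 1]].

(* [h u u] is real for a symmetric form. *)
Definition quadratic (h : V -> V -> R[i]) (u : V) : R := complex.Re (h u u).

(* The values of the form outside its domain [Q] are irrelevant. *)
Record positive_definite_form (Q : set V) (h : V -> V -> R[i]) : Prop := {
  form_subspace : subspace Q ;
  form_dense : dense Q ;
  form_linearl : forall (a : R[i]) (u v w : V), Q u -> Q v -> Q w ->
    h (a *: u + v) w = a * h u w + h v w ;
  form_linearr : forall (a : R[i]) (u v w : V), Q u -> Q v -> Q w ->
    h w (a *: u + v) = Num.conj a * h w u + h w v ;
  form_symmetric : forall u v : V, Q u -> Q v -> h u v = Num.conj (h v u) ;
  form_bounded_below : exists2 c : R, 0 < c &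
    forall u : V, Q u -> c%:C * `|u| ^+ 2 <= h u u ;
  form_closed : forall (u : nat -> V) (l : V),
    (forall n, Q (u n)) -> u @ \oo --> l ->
    (forall e : R, 0 < e -> exists N : nat, forall n k : nat,
       (N <= n)%N -> (N <= k)%N -> quadratic h (u n - u k) < e) ->
    Q l /\ quadratic h (u n - l) @[n --> \oo] --> (0 : R)
}.

(* The values of [op_fun] outside [op_dom] are irrelevant. *)
Record operator := Operator {
  op_dom : set V ;
  op_fun :> V -> V ;
  op_dom_subspace : subspace op_dom ;
  op_linear : forall (a : R[i]) (u v : V), op_dom u -> op_dom v ->
    op_fun (a *: u + v) = a *: op_fun u + op_fun v
}.

Definition graph (T : operator) : set (V * V) :=
  [set p | op_dom T p.1 /\ p.2 = T p.1].

Definition adjoint_graph (T : operator) : set (V * V) :=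
  [set p | forall u, op_dom T u -> ip (T u) p.1 = ip u p.2].

Definition selfadjoint (T : operator) : Prop :=
  dense (op_dom T) /\ adjoint_graph T = graph T.

Definition nonnegative (T : operator) : Prop :=
  forall u, op_dom T u -> 0 <= ip (T u) u.

Record square_root (S T : operator) : Prop := {
  sqrt_selfadjoint : selfadjoint S ;
  sqrt_nonnegative : nonnegative S ;
  sqrt_dom : op_dom T = [set u | op_dom S u /\ op_dom S (S u)] ;
  sqrt_sqr : forall u, op_dom T u -> T u = S (S u)
}.

Definition operator_of_form (Q : set V) (h : V -> V -> R[i]) (T : operator)
    : Prop :=
  selfadjoint T /\
  exists S : operator,
    [/\ square_root S T,
        op_dom S = Q
      & forall u v, Q u -> Q v -> h u v = ip (S u) (S v)].

Definition resolvent_set (T : operator) : set R[i] :=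
  [set z | exists B : {linear V -> V},
    [/\ continuous B,
        forall v, op_dom T (B v) /\ T (B v) - z *: B v = v
      & forall u, op_dom T u -> B (T u - z *: u) = u]].

Definition orthogonal_projection (B : {linear V -> V}) : Prop :=
  (forall u, B (B u) = B u) /\ (forall u v, ip (B u) v = ip u (B v)).

(* Only the values of [E] on Borel sets matter. *)
Record projection_valued_measure (E : set R -> {linear V -> V}) : Prop := {
  pvm_proj : forall A, measurable A -> orthogonal_projection (E A) ;
  pvm0 : forall u, E set0 u = 0 ;
  pvmT : forall u, E setT u = u ;
  pvmI : forall A B, measurable A -> measurable B ->
    forall u, E (A `&` B) u = E A (E B u) ;
  pvm_sigma_additive : forall F : nat -> set R,
    (forall n, measurable (F n)) -> trivIset setT F ->
    forall u, \sum_(0 <= k < n) E (F k) u @[n --> \oo]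
                --> E (\bigcup_k F k) u
}.

Definition scalar_measure (E : set R -> {linear V -> V}) (u : V) (A : set R)
    : \bar R := (complex.Re (ip (E A u) u))%:E.

(* [E] is the (unique) projection-valued measure given by the spectral theorem
   for [T]; the second identity determines [T] by polarization. *)
Record spectral_measure (T : operator) (E : set R -> {linear V -> V})
    : Prop := {
  spectral_pvm : projection_valued_measure E ;
  spectral_dom : op_dom T =
    [set u | (\int[scalar_measure E u]_x (x ^+ 2)%:E < +oo)%E] ;
  spectral_integral : forall u, op_dom T u ->
    ip (T u) u = (fine (\int[scalar_measure E u]_x x%:E))%:C
}.

End Hilbert.

(* Main.v *)
Require Import Defs.
From HB Require Import structures.
From mathcomp Require Import all_boot all_order all_algebra.
From mathcomp Require Import sesquilinear complex.
From mathcomp Require Import all_classical all_reals all_analysis.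
From mathcomp Require Import measurable_realfun ring lra.

Set Implicit Arguments.
Unset Strict Implicit.
Unset Printing Implicit Defensive.

Import Order.TTheory GRing.Theory Num.Theory.
Import numFieldNormedType.Exports.

Local Open Scope classical_set_scope.
Local Open Scope complex_scope.
Local Open Scope ring_scope.

(** Write [P] and [Q] for the spectral projections of [M] and [H] on
    [[L2, D1]], [P'] and [Q'] for the complementary projections. Since
    [P - Q = Q' P - Q P'], with orthogonal ranges on orthogonal subspaces, it
    is enough to bound [Q' P] and, with [H] and [M] exchanged, [P' Q]
    ([opnorm_projection_sub]).

    The resolvent hypotheses and positivity make the spectral measure of [H]
    vanish on [[L1, L2]], on [[D1, D2]] and on the nonpositive half-line
    ([pvm_null_resolvent], [pvm_null_nonpositive]), so [Q'] is the sum of the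
    spectral projections of [H] on [(0, L1]] and [[D2, oo)]. Each of the two
    pieces faces the window [[L2, D1]] of [M] across a gap, and contributes one
    of the two terms of the bound.

    The estimate across a gap ([gap_estimate]) concerns two nonnegative
    operators [A] and [B]: [u] is in a spectral subspace of [B] below [b], and
    [w] is the projection of [u] on a spectral subspace of [A] above [g > b].
    In [(A w, u) - (w, B u)] the first term is [(A w, w)], and the closeness of
    the forms bounds the difference by
    [eta * sqrt ((A w, w) * (B u, u))]. If the projection has norm at most [s]
    on the subspace of [B], then [|(w, B u)| <= |w| * s * b * |u|], and together
    with [g * |w|^2 <= (A w, w)] this gives the improved bound
    [s * (b / g) + eta * sqrt (b / g)]. The best [s] is therefore at most
    [eta * sqrt (b / g) / (1 - b / g) = eta * sqrt (g * b) / (g - b)].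
    This is the usual treatment of the operator equation
    [X - A^-1 X B = A^(-1/2) F B^(1/2)] with [|F| <= eta], written without
    inverses or square roots of operators.

    A spectral measure is tied to its operator [T] only by the domain and by
    the quadratic form [(T u, u) = \int x d(E u, u)]. What else is needed of
    the spectral theorem comes from this: the form splits along [E A] and
    [E (~` A)], and polarization then gives that [T] commutes with [E A]
    ([spectral_commute]); the bounds on [(T u, u)] coming from the support of
    the measure become bounds on [|T u|] by Cauchy-Schwarz for the form of
    [T - a] ([spectral_nrm_le]). All scalar products are replaced by their
    real parts, which form a real inner product inducing the norm and decide
    orthogonality to complex subspaces. *)

(** * The real inner product of a complex Hilbert space *)

Lemma ReD (R : realType) (x y : R[i]) :
  complex.Re (x + y) = complex.Re x + complex.Re y.
Proof. by case: x y => a b [c d]. Qed.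

Lemma ReN (R : realType) (x : R[i]) : complex.Re (- x) = - complex.Re x.
Proof. by case: x. Qed.

Lemma Re_conj (R : realType) (x : R[i]) :
  complex.Re (Num.conj x) = complex.Re x.
Proof. by case: x. Qed.

Lemma ReZ (R : realType) (a : R) (z : R[i]) :
  complex.Re (a%:C * z) = a * complex.Re z.
Proof. by case: z => b c /=; rewrite mul0r subr0. Qed.

(** Evaluating at [- b / c] gives the claim when [0 < c]; if [c <= 0], being
    nonnegative far from 0 forces [b = c = 0]. *)
Lemma discriminant_le (R : realFieldType) (a b c : R) :
  (forall t, 0 <= a + 2 * b * t + c * t ^+ 2) -> b ^+ 2 <= a * c.
Proof.
move=> pos.
have := pos 0; rewrite mulr0 expr0n mulr0 !addr0 => a_ge0.
have [c0|c_neq0] := eqVneq c 0.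
  rewrite c0 mulr0; have [->|b0] := eqVneq b 0; first by rewrite expr0n.
  have := pos (- (a + 1) / (2 * b)); rewrite c0 mul0r addr0.
  suff -> : a + 2 * b * (- (a + 1) / (2 * b)) = -1 by lra.
  by field.
have c_gt0 : 0 < c.
  rewrite lt_neqAle eq_sym c_neq0 leNgt/=; apply/negP => c_lt0.
  (* At [t] and [- t] the terms in [b] cancel, and [a + c * t ^+ 2 < 0]. *)
  have := pos (a / - c + 1); have := pos (- (a / - c + 1)).
  set t := _ / _ + 1 => h1 h2.
  have ct : c * t = - a + c by rewrite /t; field.
  have t_ge1 : 1 <= t by rewrite /t lerDr divr_ge0// oppr_ge0 ltW.
  nra.
have := pos (- b / c).
have -> : a + 2 * b * (- b / c) + c * (- b / c) ^+ 2 = (a * c - b ^+ 2) / c.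
  by field.
by rewrite pmulr_lge0 ?invr_gt0// subr_ge0.
Qed.

Section RealInnerProduct.
Context (R : realType) (V : completeNormedModType R[i]).
Context (ip : {dot V for (@Num.conj R[i])}) (ip_norm : induces_norm ip).

Definition redot (u v : V) : R := complex.Re (ip u v).
Local Notation dot := redot.
Definition nrm (u : V) : R := complex.Re `|u|.

Lemma dotDl u v w : dot (u + v) w = dot u w + dot v w.
Proof. by rewrite /redot linearDl ReD. Qed.

Lemma dotC u v : dot u v = dot v u.
Proof. by rewrite /redot (hermC ip u v) expr0 mul1r Re_conj. Qed.

Lemma dotDr u v w : dot w (u + v) = dot w u + dot w v.
Proof. by rewrite dotC dotDl !(dotC w). Qed.

Lemma dotZl (a : R) u v : dot (a%:C *: u) v = a * dot u v.
Proof. by rewrite /redot linearZl_LR ReZ. Qed.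

Lemma dotZr (a : R) u v : dot u (a%:C *: v) = a * dot u v.
Proof. by rewrite dotC dotZl dotC. Qed.

Lemma dotNl u v : dot (- u) v = - dot u v.
Proof. by rewrite /redot linearNl ReN. Qed.

Lemma dotNr u v : dot u (- v) = - dot u v.
Proof. by rewrite dotC dotNl dotC. Qed.

Lemma dotBl u v w : dot (u - v) w = dot u w - dot v w.
Proof. by rewrite dotDl dotNl. Qed.

Lemma dotBr u v w : dot w (u - v) = dot w u - dot w v.
Proof. by rewrite dotDr dotNr. Qed.

Lemma dot0l u : dot 0 u = 0.
Proof. by rewrite /redot linear0l. Qed.

Lemma normE u : `|u| = (nrm u)%:C.
Proof. by rewrite /nrm RRe_real// ger0_real. Qed.

Lemma nrm0 : nrm 0 = 0.
Proof. by rewrite /nrm normr0. Qed.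

Lemma nrm_ge0 u : 0 <= nrm u.
Proof. by rewrite -ler0c -normE. Qed.

Lemma sqr_nrm u : nrm u ^+ 2 = dot u u.
Proof. by rewrite /redot ip_norm normE -rmorphXn. Qed.

Lemma nrm_eq0 u : nrm u = 0 -> u = 0.
Proof. by move=> u0; apply/eqP; rewrite -normr_eq0 normE u0. Qed.

Lemma nrmD u v : nrm (u + v) <= nrm u + nrm v.
Proof. by rewrite -lecR rmorphD/= -!normE ler_normD. Qed.

Lemma nrmZ (a : R) u : nrm (a%:C *: u) = `|a| * nrm u.
Proof.
apply: complexI; rewrite -normE normrZ normE rmorphM/=; congr (_ * _).
by rewrite normc_def/= expr0n/= addr0 sqrtr_sqr.
Qed.

Lemma dot_le u v : dot u v <= nrm u * nrm v.
Proof.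
apply: le_trans (ler_norm _) _; rewrite -ler_sqr ?nnegrE ?mulr_ge0 ?nrm_ge0//.
rewrite real_normK ?num_real// exprMn !sqr_nrm; apply: discriminant_le => t.
have -> : dot u u + 2 * dot u v * t + dot v v * t ^+ 2
    = dot (u + t%:C *: v) (u + t%:C *: v).
  by rewrite !(dotDl, dotDr, dotZl, dotZr) (dotC v u); ring.
by rewrite -sqr_nrm exprn_ge0 ?nrm_ge0.
Qed.

Lemma pythagoras u v : dot u v = 0 ->
  nrm (u - v) ^+ 2 = nrm u ^+ 2 + nrm v ^+ 2.
Proof.
by move=> uv; rewrite !sqr_nrm !(dotBl, dotBr) (dotC v u) uv; ring.
Qed.

(** The form in which Cauchy-Schwarz estimates are turned into norm bounds: it
    spares the case distinction on [nrm u = 0] when dividing. *)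
Lemma nrm_le_of_sqr u (c : R) : 0 <= c -> dot u u <= c * nrm u -> nrm u <= c.
Proof.
move=> c0; rewrite -sqr_nrm => ucu; have := nrm_ge0 u.
by rewrite le_eqVlt => /predU1P[<-//|u0]; rewrite -(ler_pM2r u0) -expr2.
Qed.

Lemma cvg_nrm (x : nat -> V) (l : V) : x @ \oo --> l ->
  forall e : R, 0 < e -> \forall n \near \oo, nrm (l - x n) < e.
Proof.
move=> /cvgrPdist_lt xl e e0.
have e0C : 0 < e%:C :> R[i] by rewrite ltcR.
by have := xl _ e0C; apply: filterS => n; rewrite normE ltcR.
Qed.

Lemma cvg_dotl (x : nat -> V) (l v : V) : x @ \oo --> l ->
  dot (x n) v @[n --> \oo] --> dot l v.
Proof.
move=> xl; apply/cvgrPdist_le => e e0.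
have d0 : 0 < e / (nrm v + 1) by rewrite divr_gt0// ltr_wpDl// nrm_ge0.
have := cvg_nrm xl d0; apply: filterS => n xn.
have bnd w : nrm w < e / (nrm v + 1) -> dot w v <= e.
  move=> we; apply: le_trans (dot_le _ _) _.
  apply: (@le_trans _ _ (nrm w * (nrm v + 1))).
    by rewrite ler_wpM2l ?nrm_ge0 // lerDl.
  by rewrite -ler_pdivlMr ?(ltW we)// ltr_wpDl// nrm_ge0.
rewrite -dotBl ler_norml (bnd _ xn) andbT lerNl -dotNl; apply: bnd.
by rewrite /nrm normrN.
Qed.

(** A vector [v] of [D] at distance less than [nrm x] from [x] cannot be
    orthogonal to [x], by Pythagoras. *)
Lemma dense_dot_eq0 (D : set V) (x : V) : dense D ->
  (forall v, D v -> dot x v = 0) -> x = 0.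
Proof.
move=> dD xD; apply/eqP/negPn/negP => x0.
have [] := dD (ball x `|x|); [|exact: ball_open|].
  by exists x; apply: ballxx; rewrite normr_gt0.
move=> v [+ Dv]; rewrite -ball_normE/= !normE ltcR => xv.
have : nrm (x - v) ^+ 2 < nrm x ^+ 2.
  by rewrite ltr_sqr ?nnegrE ?nrm_ge0.
rewrite !sqr_nrm !(dotBl, dotBr) (dotC v x) (xD _ Dv) subr0 sub0r opprK.
by rewrite ltNge lerDl -sqr_nrm exprn_ge0 ?nrm_ge0.
Qed.

Lemma projK B u : orthogonal_projection ip B -> B (B u) = B u.
Proof. by case. Qed.

Lemma proj_dot B u v : orthogonal_projection ip B -> dot (B u) v = dot u (B v).
Proof. by case=> _ pB; rewrite /redot pB. Qed.

Lemma proj_sqr B u : orthogonal_projection ip B -> dot (B u) u = nrm (B u) ^+ 2.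
Proof. by move=> pB; rewrite sqr_nrm [RHS](proj_dot _ _ pB) projK// dotC. Qed.

Lemma proj_nrm B u : orthogonal_projection ip B -> nrm (B u) <= nrm u.
Proof.
move=> pB; apply: nrm_le_of_sqr; first exact: nrm_ge0.
by rewrite (proj_dot _ _ pB) projK// dot_le.
Qed.

End RealInnerProduct.

(** * Projection-valued measures *)

Section ProjectionValuedMeasure.
Context (R : realType) (V : completeNormedModType R[i]).
Context (ip : {dot V for (@Num.conj R[i])}) (ip_norm : induces_norm ip).
Context (E : set R -> {linear V -> V}) (pE : projection_valued_measure ip E).
Local Notation dot := (redot ip).

Lemma pvm_dot A u v : measurable A -> dot (E A u) v = dot u (E A v).
Proof. by move=> mA; apply: proj_dot; exact: pvm_proj. Qed.

Lemma pvm_idem A u : measurable A -> E A (E A u) = E A u.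
Proof. by move=> mA; rewrite (projK _ (pvm_proj pE mA)). Qed.

Lemma pvm_sqr A u : measurable A -> dot (E A u) u = nrm (E A u) ^+ 2.
Proof. by move=> mA; apply: proj_sqr => //; exact: pvm_proj. Qed.

Lemma pvm_nrm A u : measurable A -> nrm (E A u) <= nrm u.
Proof. by move=> mA; apply: proj_nrm => //; exact: pvm_proj. Qed.

Lemma pvm_disj A B u : measurable A -> measurable B -> A `&` B = set0 ->
  E A (E B u) = 0.
Proof. by move=> mA mB AB; rewrite -(pvmI pE)// AB (pvm0 pE). Qed.

Lemma pvmU A B u : measurable A -> measurable B -> A `&` B = set0 ->
  E (A `|` B) u = E A u + E B u.
Proof.
move=> mA mB AB.
have mF n : measurable (bigcup2 A B n) by rewrite /bigcup2; do 2?case: ifP.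
have tF : trivIset setT (bigcup2 A B) by rewrite -trivIset_bigcup2.
have := pvm_sigma_additive pE mF tF (u := u); rewrite bigcup2E => /cvg_nrm EF.
apply/eqP; rewrite -subr_eq0; apply/eqP/(@nrm_eq0 R); apply/eqP.
rewrite eq_le nrm_ge0 andbT; apply/ler_addgt0Pl => e e0; rewrite addr0.
(* The partial sums are constant from the second one on; the index [N + 2]
   exposes the two nonzero terms. *)
have [N _ /(_ (N + 2)%N)] := EF _ e0.
move=> /(_ (leq_addr _ _)); rewrite addnC big_nat_recl// big_nat_recl//=.
rewrite big1 ?addr0; first exact: ltW.
by move=> i _; rewrite (pvm0 pE).
Qed.

Lemma pvmC A u : measurable A -> u = E A u + E (~` A) u.
Proof.
move=> mA; rewrite -pvmU ?setICr//; last exact: measurableC.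
by rewrite setUv (pvmT pE).
Qed.

Definition pvm_null (A : set R) := forall u, E A u = 0.

Lemma pvm_null_sub A B : measurable A -> measurable B -> A `<=` B ->
  pvm_null B -> pvm_null A.
Proof.
move=> mA mB AB B0 u; rewrite -[RHS](linear0 (E A)) -(B0 u) -(pvmI pE)//.
by rewrite (setIidl AB).
Qed.

Lemma pvm_nullU A B : measurable A -> measurable B -> pvm_null A ->
  pvm_null B -> pvm_null (A `|` B).
Proof.
move=> mA mB A0 B0 u; have mBA : measurable (B `\` A) by exact: measurableD.
have -> : A `|` B = A `|` (B `\` A).
  apply/seteqP; split => x/=; last by case=> [|[]]; [left|right].
  by case=> [|xB]; [left|have [xA|xA] := pselect (A x); [left|right]].
rewrite pvmU//; last by rewrite setIC setDKI.
rewrite A0 add0r; exact: (pvm_null_sub mBA mB (@subDsetl _ _ _) B0).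
Qed.

Lemma pvm_null_eq A N C : measurable A -> measurable N -> measurable C ->
  A `<=` C -> C `<=` A `|` N -> pvm_null N -> forall u, E C u = E A u.
Proof.
move=> mA mN mC AC CAN N0 u.
have mCA : measurable (C `\` A) by exact: measurableD.
have -> : C = A `|` (C `\` A) by rewrite setDUK.
rewrite pvmU//; last by rewrite setIC setDKI.
have -> : E (C `\` A) u = 0; last by rewrite addr0.
apply: (pvm_null_sub mCA mN _ N0) => x [Cx Ax].
by have [] := CAN _ Cx.
Qed.

(** [scalar_measure] can be negative on sets that are not measurable, which the
    structure of measures forbids; setting it to 0 there changes no integral. *)
Definition pvm_mu (u : V) (A : set R) : \bar R :=
  if `[< measurable A >] then (dot (E A u) u)%:E else 0%E.

Lemma pvm_muE u A : measurable A -> pvm_mu u A = (dot (E A u) u)%:E.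
Proof. by move=> mA; rewrite /pvm_mu asboolT. Qed.

Let pvm_mu0 u : pvm_mu u set0 = 0%E.
Proof. by rewrite pvm_muE// (pvm0 pE) dot0l. Qed.

Let pvm_mu_ge0 u A : (0 <= pvm_mu u A)%E.
Proof.
rewrite /pvm_mu; case: asboolP => // mA.
by rewrite lee_fin pvm_sqr// exprn_ge0// nrm_ge0.
Qed.

Let pvm_mu_sigma u : semi_sigma_additive (pvm_mu u).
Proof.
move=> F mF tF mUF; rewrite pvm_muE//.
have -> : (fun n => \sum_(0 <= i < n) pvm_mu u (F i))%E
    = EFin \o (fun n => dot (\sum_(0 <= i < n) E (F i) u) u).
  apply/funext => n /=.
  rewrite (big_morph (fun x => dot x u)
    (fun x y => dotDl ip x y u) (dot0l ip u)) -sumEFin.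
  by apply: eq_bigr => i _; rewrite pvm_muE//.
apply: cvg_EFin; first by apply: nearW.
by apply: cvg_dotl => //; exact: (pvm_sigma_additive pE mF tF (u := u)).
Qed.

HB.instance Definition _ u := isMeasure.Build _ _ _ (pvm_mu u)
  (pvm_mu0 u) (pvm_mu_ge0 u) (@pvm_mu_sigma u).

Import HBNNSimple.

(** A simple function only evaluates the measure on its level sets, which are
    measurable. *)
Lemma scalar_measureE u (f : R -> \bar R) :
  (\int[scalar_measure ip E u]_x f x = \int[pvm_mu u]_x f x)%E.
Proof.
rewrite /integral; congr (ereal_sup _ - ereal_sup _)%E;
  apply/seteqP; split => _ [g gf <-]; exists g => //; apply: eq_fsbigr => r _;
  by rewrite pvm_muE// -[X in measurable X]setTI; apply: measurable_funP.
Qed.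

Let pvm_mu_fin u : fin_num_fun (pvm_mu u).
Proof. by move=> A mA; rewrite pvm_muE. Qed.

HB.instance Definition _ u :=
  Measure_isFinite.Build _ _ _ (pvm_mu u) (pvm_mu_fin u).

(** The cross terms vanish because [E B] commutes with [E A], so that [E B a]
    and [b] lie in orthogonal subspaces. *)
Lemma pvm_mu_split A a b B : measurable A -> measurable B ->
  E A a = a -> E (~` A) b = b ->
  pvm_mu (a + b) B = (pvm_mu a B + pvm_mu b B)%E.
Proof.
move=> mA mB Aa Ab; have mA' := measurableC mA.
have cross : dot (E B a) b = 0.
  rewrite -Aa -Ab -pvm_dot// -!(pvmI pE)//; last exact: measurableI.
  by rewrite setIC setIA setICr set0I (pvm0 pE) dot0l.
rewrite !pvm_muE// -EFinD; congr EFin.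
rewrite linearD !(dotDl, dotDr) cross [dot (E B b) a]pvm_dot//.
by rewrite [dot b _]dotC cross add0r addr0.
Qed.

Lemma pvm_mu_null A u : measurable A -> E A u = u -> pvm_mu u (~` A) = 0%E.
Proof.
move=> mA Au; have mA' := measurableC mA.
by rewrite pvm_muE// -Au pvm_disj ?setICl// dot0l.
Qed.

Let measurable_id_EFin : measurable_fun setT (fun x : R => x%:E).
Proof. exact/measurable_EFinP. Qed.

Let measurable_sqr_EFin : measurable_fun setT (fun x : R => (x ^+ 2)%:E).
Proof. by apply/measurable_EFinP; exact: exprn_measurable. Qed.

Lemma second_moment_ge0 u :
  (0 <= \int[scalar_measure ip E u]_x (x ^+ 2)%:E)%E.
Proof.
by rewrite scalar_measureE integral_ge0// => x _; rewrite lee_fin sqr_ge0.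
Qed.

Lemma second_moment_split A a b : measurable A -> E A a = a -> E (~` A) b = b ->
  (\int[scalar_measure ip E (a + b)%R]_x (x ^+ 2)%:E
   = \int[scalar_measure ip E a]_x (x ^+ 2)%:E
     + \int[scalar_measure ip E b]_x (x ^+ 2)%:E)%E.
Proof.
rewrite !scalar_measureE.
move=> mA Aa Ab.
rewrite (eq_measure_integral (measure_add (pvm_mu a) (pvm_mu b))).
  rewrite ge0_integral_measure_add// => x _.
  by rewrite lee_fin sqr_ge0.
move=> B mB _; apply: etrans (pvm_mu_split mA mB Aa Ab) _.
exact/esym/measure_addE.
Qed.

Lemma first_moment_integrable u : (\int[pvm_mu u]_x (x ^+ 2)%:E < +oo)%E ->
  (pvm_mu u).-integrable setT (fun x : R => x%:E).
Proof.
move=> fin; have i2 : (pvm_mu u).-integrable setT (fun x : R => (x ^+ 2)%:E).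
  apply/integrableP; split => //; under eq_integral => x _ do
    rewrite gee0_abs ?lee_fin ?sqr_ge0//.
  exact: fin.
have i1 := finite_measure_integrable_cst (pvm_mu u) 1 (@measurableT _ R).
apply: le_integrable (integrableD _ i1 i2) => // x _.
rewrite /= lee_fin [leRHS]ger0_norm ?addr_ge0 ?sqr_ge0//.
(* The measure is finite and [`|x| <= 1 + x ^+ 2]. *)
rewrite -(real_normK (num_real x)); have := normr_ge0 x; nra.
Qed.

Lemma first_moment_split A a b : measurable A -> E A a = a -> E (~` A) b = b ->
  (\int[scalar_measure ip E a]_x (x ^+ 2)%:E < +oo)%E ->
  (\int[scalar_measure ip E b]_x (x ^+ 2)%:E < +oo)%E ->
  fine (\int[scalar_measure ip E (a + b)%R]_x x%:E)
  = fine (\int[scalar_measure ip E a]_x x%:E)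
    + fine (\int[scalar_measure ip E b]_x x%:E).
Proof.
rewrite !scalar_measureE.
move=> mA Aa Ab /first_moment_integrable ia /first_moment_integrable ib.
rewrite -fineD ?integrable_fin_num//; congr fine.
rewrite (eq_measure_integral (measure_add (pvm_mu a) (pvm_mu b))).
  by rewrite integral_measure_add.
move=> B mB _; apply: etrans (pvm_mu_split mA mB Aa Ab) _.
exact/esym/measure_addE.
Qed.

Lemma second_moment_bounded A u (c : R) : measurable A -> E A u = u ->
  (forall x, A x -> `|x| <= c) ->
  (\int[scalar_measure ip E u]_x (x ^+ 2)%:E < +oo)%E.
Proof.
rewrite !scalar_measureE.
move=> mA Au Ac; rewrite (ge0_negligible_integral (measurableC mA))//.
- rewrite setDE setCK setTI.
  apply: (@le_lt_trans _ _ (\int[pvm_mu u]_(x in A) (cst (c ^+ 2)%:E) x)%E).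
    apply: ge0_le_integral => //.
    + by move=> x _; rewrite lee_fin sqr_ge0.
    + exact: measurable_funTS.
    + move=> x /Ac xc; rewrite lee_fin -(real_normK (num_real x)).
      by rewrite lerXn2r ?nnegrE// (le_trans _ xc).
  rewrite integral_cst//= pvm_muE// -EFinM; exact: ltry.
- by move=> x _; rewrite lee_fin sqr_ge0.
- exact: pvm_mu_null.
Qed.

Lemma first_moment_ge A u (c : R) : measurable A -> E A u = u ->
  (\int[scalar_measure ip E u]_x (x ^+ 2)%:E < +oo)%E ->
  (forall x, A x -> c <= x) ->
  c * nrm u ^+ 2 <= fine (\int[scalar_measure ip E u]_x x%:E).
Proof.
rewrite !scalar_measureE.
move=> mA Au /first_moment_integrable iu Ac.
rewrite -lee_fin fineK ?integrable_fin_num//.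
rewrite (negligible_integral (measurableC mA))//; last exact: pvm_mu_null.
rewrite setDE setCK setTI.
have -> : (c * nrm u ^+ 2)%:E = (\int[pvm_mu u]_(x in A) (cst c%:E) x)%E.
  by rewrite integral_cst//= pvm_muE// Au (sqr_nrm ip_norm).
apply: le_integral => //.
- exact: finite_measure_integrable_cst.
- exact: integrableS iu.
- by move=> x xA; rewrite lee_fin Ac//; exact: set_mem.
Qed.

Lemma first_moment_le A u (c : R) : measurable A -> E A u = u ->
  (\int[scalar_measure ip E u]_x (x ^+ 2)%:E < +oo)%E ->
  (forall x, A x -> x <= c) ->
  fine (\int[scalar_measure ip E u]_x x%:E) <= c * nrm u ^+ 2.
Proof.
rewrite !scalar_measureE.
move=> mA Au /first_moment_integrable iu Ac.
rewrite -lee_fin fineK ?integrable_fin_num//.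
rewrite (negligible_integral (measurableC mA))//; last exact: pvm_mu_null.
rewrite setDE setCK setTI.
have -> : (c * nrm u ^+ 2)%:E = (\int[pvm_mu u]_(x in A) (cst c%:E) x)%E.
  by rewrite integral_cst//= pvm_muE// Au (sqr_nrm ip_norm).
apply: le_integral => //.
- exact: integrableS iu.
- exact: finite_measure_integrable_cst.
- by move=> x xA; rewrite lee_fin Ac//; exact: set_mem.
Qed.

Lemma pvm_nrm_limit u (a c : R) : 0 <= c ->
  (forall b : R, a <= b -> nrm (E [set` `[a, b]] u) <= c) ->
  nrm (E [set` `[a, +oo[] u) <= c.
Proof.
move=> c0 bnd.
pose F (n : nat) : set R := [set` `[a, a + n%:R]].
have mF n : measurable (F n) by exact: measurable_itv.
have mUF : measurable (\bigcup_n F n) by exact: bigcup_measurable.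
have -> : [set` `[a, +oo[] = \bigcup_n F n.
  apply/seteqP; split => [x/=|x [n _]]; rewrite /F/= !in_itv/= ?andbT.
    move=> ax; exists (Num.truncn (x - a)).+1 => //=; rewrite in_itv/= ax/=.
    by rewrite -lerBlDl ltW// truncnS_gt.
  by case/andP.
have ndF : nondecreasing_seq F.
  move=> n m nm; apply/subsetPset => x; rewrite /F/= !in_itv/= => /andP[-> xn].
  by rewrite (le_trans xn)// lerD2l ler_nat.
have Fcvg := nondecreasing_cvg_mu (mu := pvm_mu u) mF mUF ndF.
rewrite -ler_sqr ?nnegrE ?nrm_ge0// -pvm_sqr// -lee_fin -pvm_muE//.
rewrite -(cvg_lim _ Fcvg)//; apply: lime_le.
  by apply/cvg_ex; eexists; exact: Fcvg.
apply: nearW => n /=; rewrite pvm_muE// lee_fin pvm_sqr//.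
by rewrite ler_sqr ?nnegrE ?nrm_ge0// bnd// lerDl.
Qed.

End ProjectionValuedMeasure.

(** * Spectral subspaces of a selfadjoint operator *)

Section SpectralMeasure.
Context (R : realType) (V : completeNormedModType R[i]).
Context (ip : {dot V for (@Num.conj R[i])}) (ip_norm : induces_norm ip).
Context (T : operator V) (T_sa : selfadjoint ip T).
Context (E : set R -> {linear V -> V}) (T_sp : spectral_measure ip T E).
Local Notation dot := (redot ip).
Local Notation pE := (spectral_pvm T_sp).

Lemma op_dom0 : op_dom T 0.
Proof. by have [] := op_dom_subspace T. Qed.

Lemma op_domD u v : op_dom T u -> op_dom T v -> op_dom T (u + v).
Proof.
by have [_ h] := op_dom_subspace T; rewrite -{2}(scale1r u); exact: h.
Qed.

Lemma op_domZ (a : R[i]) u : op_dom T u -> op_dom T (a *: u).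
Proof.
by have [_ h] := op_dom_subspace T; rewrite -(addr0 (_ *: u)) => Tu;
  exact: h op_dom0.
Qed.

Lemma opD u v : op_dom T u -> op_dom T v -> T (u + v) = T u + T v.
Proof.
by move=> Tu Tv; have := op_linear 1 Tu Tv; rewrite !scale1r.
Qed.

Lemma opZ (a : R[i]) u : op_dom T u -> T (a *: u) = a *: T u.
Proof.
move=> Tu; have T0 : T 0 = 0.
  have := opD op_dom0 op_dom0; rewrite addr0 => /eqP.
  by rewrite -[X in X == _]addr0 (inj_eq (addrI _)) eq_sym => /eqP.
by have := op_linear a Tu op_dom0; rewrite addr0 T0 addr0.
Qed.

Lemma op_symmetric u v : op_dom T u -> op_dom T v -> dot (T u) v = dot u (T v).
Proof.
move=> Tu Tv; have [_ adj] := T_sa.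
have : adjoint_graph ip T (v, T v) by rewrite adj.
by move=> /(_ _ Tu)/= h; rewrite /redot h.
Qed.

Lemma op_dom_moment u :
  op_dom T u <-> (\int[scalar_measure ip E u]_x (x ^+ 2)%:E < +oo)%E.
Proof. by rewrite (spectral_dom T_sp). Qed.

Lemma op_form_moment u : op_dom T u ->
  dot (T u) u = fine (\int[scalar_measure ip E u]_x x%:E)%E.
Proof.
by move=> Tu; rewrite /redot (spectral_integral T_sp Tu).
Qed.

(** By [second_moment_split] the second moment of [E A u] is at most that of
    [u]. *)
Lemma spectral_dom_proj A u : measurable A -> op_dom T u -> op_dom T (E A u).
Proof.
move=> mA /op_dom_moment; rewrite {1}(pvmC pE u mA) => fin.
apply/op_dom_moment; apply: le_lt_trans fin.
rewrite (second_moment_split ip_norm pE mA); last 2 first.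
- exact: (pvm_idem pE).
- by apply: (pvm_idem pE); exact: measurableC.
by rewrite leeDl// (second_moment_ge0 ip_norm pE).
Qed.

(** Comparing the form at [u + v] with its values at [u] and [v] gives
    [dot (T u) v + dot (T v) u = 0], and the two terms are equal because [T] is
    symmetric. *)
Lemma spectral_orthogonal A u v : measurable A -> op_dom T u -> op_dom T v ->
  E A u = u -> E (~` A) v = v -> dot (T u) v = 0.
Proof.
move=> mA Tu Tv Au Av.
have := first_moment_split ip_norm pE mA Au Av.
move=> /(_ ((op_dom_moment u).1 Tu) ((op_dom_moment v).1 Tv)).
rewrite -!op_form_moment//; last exact: op_domD.
rewrite opD// !(dotDl, dotDr) (op_symmetric Tv)// (dotC ip _ v); lra.
Qed.

(** Orthogonality to the range of [E (~` A)] intersected with the dense domain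
    forces [T (E A u)] into the range of [E A], and symmetrically for the
    complement. *)
Lemma spectral_commute A u : measurable A -> op_dom T u ->
  T (E A u) = E A (T u).
Proof.
move=> mA Tu.
have key B : measurable B -> E (~` B) (T (E B u)) = 0.
  move=> mB; have mB' := measurableC mB.
  apply: (dense_dot_eq0 ip_norm T_sa.1) => v Tv; rewrite (pvm_dot pE)//.
  apply: (spectral_orthogonal mB); rewrite ?(pvm_idem pE)//;
    exact: spectral_dom_proj.
have mA' := measurableC mA.
have TA := spectral_dom_proj mA Tu; have TA' := spectral_dom_proj mA' Tu.
rewrite [in RHS](pvmC pE u mA) opD// linearD/=.
have := key _ mA'; rewrite setCK => ->; rewrite addr0.
by rewrite {1}(pvmC pE (T _) mA) key// addr0.
Qed.

Lemma spectral_form_ge A u (c : R) : measurable A -> E A u = u -> op_dom T u ->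
  (forall x, A x -> c <= x) -> c * nrm u ^+ 2 <= dot (T u) u.
Proof.
move=> mA Au Tu Ac; rewrite op_form_moment//.
by apply: (first_moment_ge ip_norm pE mA Au ((op_dom_moment u).1 Tu)).
Qed.

Lemma spectral_form_le A u (c : R) : measurable A -> E A u = u -> op_dom T u ->
  (forall x, A x -> x <= c) -> dot (T u) u <= c * nrm u ^+ 2.
Proof.
move=> mA Au Tu Ac; rewrite op_form_moment//.
by apply: (first_moment_le ip_norm pE mA Au ((op_dom_moment u).1 Tu)).
Qed.

Lemma spectral_dom_bounded A u (c : R) : measurable A -> E A u = u ->
  (forall x, A x -> `|x| <= c) -> op_dom T u.
Proof.
move=> mA Au Ac; apply/op_dom_moment.
exact: (second_moment_bounded ip_norm pE mA Au Ac).
Qed.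

(** On the range of [E A] the form [f] of [T - a] lies between 0 and [b - a]
    times the squared norm. Cauchy-Schwarz for [f] at [u] and
    [w = T u - a u] reads [|w|^4 <= f u * f w <= (b - a)^2 * |u|^2 * |w|^2]. *)
Lemma spectral_nrm_le A u (a b : R) : measurable A -> E A u = u -> a <= b ->
  (forall x, A x -> a <= x <= b) -> nrm (T u - a%:C *: u) <= (b - a) * nrm u.
Proof.
move=> mA Au ab Aab.
have Tdom v : E A v = v -> op_dom T v.
  move=> Av; apply: (spectral_dom_bounded (c := `|a| + `|b|) mA Av) => x.
  move=> /Aab ?; rewrite ler_norml; have := ler_norm b.
  have := ler_norm (- a); have := normr_ge0 a; have := normr_ge0 b.
  by rewrite normrN; lra.
have Tu := Tdom _ Au; set w := T u - _.
have Aw : E A w = w.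
  by rewrite /w linearB/= linearZ/= -spectral_commute// Au.
have Tw := Tdom _ Aw.
pose f v := dot (T v) v - a * dot v v.
have f_ge0 v : E A v = v -> 0 <= f v.
  move=> Av; rewrite subr_ge0 -(sqr_nrm ip_norm).
  by apply: (spectral_form_ge mA) => //; [exact: Tdom|move=> x /Aab/andP[]].
have f_le v : E A v = v -> f v <= (b - a) * nrm v ^+ 2.
  move=> Av; rewrite mulrBl (sqr_nrm ip_norm) lerB// -(sqr_nrm ip_norm).
  by apply: (spectral_form_le mA) => //; [exact: Tdom|move=> x /Aab/andP[]].
have uw : dot (T u) w - a * dot u w = nrm w ^+ 2.
  by rewrite (sqr_nrm ip_norm) {3}/w dotBl dotZl.
clearbody w.
have : (nrm w ^+ 2) ^+ 2 <= f u * f w.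
  apply: discriminant_le => t.
  have -> : f u + 2 * nrm w ^+ 2 * t + f w * t ^+ 2 = f (u + t%:C *: w).
    rewrite /f.
    have -> : T (u + t%:C *: w) = T u + t%:C *: T w.
      by rewrite -opZ// opD//; exact: op_domZ.
    rewrite !(dotDl, dotDr, dotZl, dotZr) -uw (op_symmetric Tw Tu).
    by rewrite (dotC ip w (T u)) (dotC ip w u); ring.
  by apply: f_ge0; rewrite linearD/= linearZ/= Au Aw.
have := f_le _ Au; have := f_le _ Aw; have := f_ge0 _ Au; have := f_ge0 _ Aw.
move=> fw0 fu0 fw fu h.
have ba : 0 <= b - a by rewrite subr_ge0.
have nw := @nrm_ge0 _ _ w; have nu := @nrm_ge0 _ _ u.
have [->|w0] := eqVneq (nrm w) 0; first by rewrite mulr_ge0.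
have {}w0 : 0 < nrm w by rewrite lt_neqAle eq_sym w0.
rewrite -ler_sqr ?nnegrE ?mulr_ge0//.
rewrite -(ler_pM2r (exprn_gt0 2 w0)) -expr2.
apply: (le_trans h); apply: (le_trans (ler_pM _ _ fu fw)) => //.
by rewrite le_eqVlt; apply/orP; left; apply/eqP; ring.
Qed.

(** The constant is a bound for the norm of the resolvent, which continuity at 0
    provides. *)
Lemma resolvent_bound (x : R) : resolvent_set T x%:C ->
  exists2 K : R, 0 < K & forall u, op_dom T u ->
    nrm u <= K * nrm (T u - x%:C *: u).
Proof.
move=> [B [cB _ BT]].
have : \forall v \near (0 : V), `|B 0 - B v| < 1.
  by have /cvgrPdist_lt := cB 0; apply.
move=> /nbhs_ballP[e /= e0]; rewrite linear0 => Be.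
have [r r0 re] : exists2 r : R, 0 < r & e = r%:C.
  exists (complex.Re e); first by move: e0; rewrite ltcE => /andP[].
  by rewrite RRe_real// gtr0_real.
subst e; exists (2 / r) => [|u Tu]; first by rewrite divr_gt0.
set v := T u - _; have Bv : B v = u by exact: BT.
have [v0|v_neq0] := eqVneq (nrm v) 0.
  by rewrite -Bv (nrm_eq0 v0) linear0 nrm0 mulr0.
have v_gt0 : 0 < nrm v by rewrite lt_neqAle eq_sym v_neq0 nrm_ge0.
pose s := r / (2 * nrm v); have s0 : 0 < s by rewrite divr_gt0 ?mulr_gt0.
have /Be : ball (0 : V) r%:C (s%:C *: v).
  rewrite -ball_normE/= sub0r normrN normE ltcR nrmZ gtr0_norm//.
  have -> : s * nrm v = r / 2 by rewrite /s; field.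
  by rewrite ltr_pdivrMr// ltr_pMr// ltr1n.
rewrite /= sub0r normrN linearZ/= Bv normE -[1]/((1 : R)%:C) ltcR nrmZ.
rewrite gtr0_norm// => su; have : nrm u < s^-1.
  by rewrite -[ltRHS]mul1r ltr_pdivlMr// mulrC.
by move=> /ltW/le_trans; apply; rewrite /s invf_div mulrAC.
Qed.

(** On the range of [E] of an interval of radius [r] around [x],
    [|T v - x v| <= 3 r |v|], while the resolvent gives
    [|v| <= K |T v - x v|]; hence [v = 0] as soon as [3 r K < 1]. *)
Lemma pvm_null_near_resolvent (x : R) : resolvent_set T x%:C ->
  exists2 r : R, 0 < r & pvm_null E [set` `[x - r, x + r]].
Proof.
move=> /resolvent_bound[K K0 HK]; pose r := (4 * K)^-1.
have r0 : 0 < r by rewrite invr_gt0 mulr_gt0.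
pose J : set R := [set` `[x - r, x + r]].
exists r => // u; have m : measurable J by exact: measurable_itv.
set v := E _ u; have Ev : E J v = v by exact: (pvm_idem pE).
have Tv : op_dom T v.
  apply: (spectral_dom_bounded (c := `|x| + r) m Ev) => y.
  rewrite /J/= in_itv/= ler_norml => /andP[y1 y2].
  by have := ler_norm x; have := ler_norm (- x); rewrite normrN; lra.
have rr : x - r <= x + r by lra.
have := spectral_nrm_le m Ev rr; set w := T v - _.
(* [spectral_nrm_le] compares [T] with the left end point: [|w| <= 2 r |v|]. *)
have -> : x + r - (x - r) = 2 * r by ring.
move=> /(_ (fun y yx => yx)) wv.
have xw : T v - x%:C *: v = w + (- r)%:C *: v.
  rewrite /w -addrA -!scaleNr -scalerDl; congr (_ + _ *: _).
  by rewrite -!rmorphN -rmorphD/=; congr (_%:C); ring.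
have := HK v Tv; rewrite xw => h.
have : nrm (w + (- r)%:C *: v) <= 3 * r * nrm v.
  apply: (le_trans (nrmD _ _)); rewrite nrmZ normrN gtr0_norm//; lra.
rewrite -(ler_pM2l K0) => /(le_trans h); rewrite !mulrA.
have -> : K * 3 * r = 3 / 4 by rewrite /r; field; rewrite gt_eqF.
move=> hv; apply: nrm_eq0; have := nrm_ge0 v; lra.
Qed.

(** A continuity argument: the supremum [s] of the [t] for which [[a, t]] is
    null is attained and equals [b], since a neighbourhood of [s] is null. *)
Lemma pvm_null_resolvent (a b : R) : a <= b ->
  (forall x, a <= x <= b -> resolvent_set T x%:C) -> pvm_null E [set` `[a, b]].
Proof.
move=> ab res.
pose S := [set t | t <= b /\ a <= t /\ pvm_null E [set` `[a, t]]].
have loc x : a <= x <= b ->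
    exists2 r : R, 0 < r & pvm_null E [set` `[x - r, x + r]].
  by move=> /res/pvm_null_near_resolvent.
have Sa : S a.
  split => //; split => //; have [|r r0] := loc a; first by rewrite lexx.
  by apply: (pvm_null_sub pE) => // x/=; rewrite !in_itv/=; lra.
have Sb : ubound S b by move=> t [].
have supS : has_sup S by split; [exists a|exists b].
have as_ : a <= sup S by apply: ub_le_sup => //; exists b.
have sb : sup S <= b by apply: ge_sup => //; exists a.
have [|r r0 r_null] := loc (sup S); first by rewrite as_.
have [t St tr] := sup_adherent r0 supS.
have [tb [at_ t_null]] := St.
have ts : t <= sup S by apply: ub_le_sup => //; exists b.
pose t' := Num.min b (sup S + r).
have t'_null : pvm_null E [set` `[a, t']].
  apply: (pvm_null_sub pE) (pvm_nullU pE _ _ t_null r_null) => //.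
    exact: measurableU.
  move=> x/=; rewrite !in_itv/= => /andP[ax]; rewrite le_min => /andP[xb xs].
  by case/orP: (le_total x t) => xt; [left|right]; rewrite /=; lra.
have : t' <= sup S.
  apply: ub_le_sup; first by exists b.
  split; first by rewrite ge_min lexx.
  by split => //; rewrite le_min ab/=; lra.
rewrite ge_min => /orP[bs|]; last by lra.
by move: t'_null; rewrite /t' min_l//; lra.
Qed.

(** A vector [v] of the domain in the range of the projection has
    [(T v, v) <= 0], hence is 0; density of the domain extends this to all
    vectors. *)
Lemma pvm_null_nonpositive (c : R) : 0 < c ->
  (forall u, op_dom T u -> c * nrm u ^+ 2 <= dot (T u) u) ->
  pvm_null E [set` `]-oo, (0 : R)]].
Proof.
move=> c0 pos u.
have m : measurable [set` `]-oo, (0 : R)]] by exact: measurable_itv.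
apply: (dense_dot_eq0 ip_norm T_sa.1) => v Tv; rewrite (pvm_dot pE)//.
suff -> : E [set` `]-oo, (0 : R)]] v = 0 by rewrite dotC dot0l.
have TEv := spectral_dom_proj m Tv.
have := spectral_form_le m (pvm_idem pE v m) TEv (c := 0).
move=> /(_ (fun x => id)).
rewrite mul0r => h; have := le_trans (pos _ TEv) h.
rewrite pmulr_rle0// => h2; apply: nrm_eq0; apply/eqP.
by rewrite -sqrf_eq0 eq_le h2 sqr_ge0.
Qed.

End SpectralMeasure.

(** * Operators defined by close forms *)

Section FormOperators.
Context (R : realType) (V : completeNormedModType R[i]).
Context (ip : {dot V for (@Num.conj R[i])}) (ip_norm : induces_norm ip).
Local Notation dot := (redot ip).

Section OneForm.
Context (Q : set V) (h : V -> V -> R[i]) (T : operator V).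
Context (h_form : positive_definite_form Q h)
  (T_op : operator_of_form ip Q h T).

Lemma op_dom_form u : op_dom T u -> Q u.
Proof.
by have [_ [S [sq <- _]]] := T_op; rewrite (sqrt_dom sq) => -[].
Qed.

(** The representation theorem: [h u v = (S u, S v) = (S (S u), v)], as [S] is
    selfadjoint. *)
Lemma form_op u v : op_dom T u -> Q v -> complex.Re (h u v) = dot (T u) v.
Proof.
have [_ [S [sq SQ hS]]] := T_op => Tu Qv.
have Qu := op_dom_form Tu; rewrite hS// (sqrt_sqr sq Tu) /redot.
have [_ adj] := sqrt_selfadjoint sq.
have : adjoint_graph ip S (v, S v) by rewrite adj; split => //=; rewrite SQ.
move=> /(_ (S u))/= ->//.
by move: Tu; rewrite (sqrt_dom sq) => -[].
Qed.

Lemma form_symmetric_re u v : Q u -> Q v ->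
  complex.Re (h u v) = complex.Re (h v u).
Proof.
by move=> Qu Qv; rewrite (form_symmetric h_form Qu Qv); case: (h v u).
Qed.

Lemma form_op_bounded_below : exists2 c : R, 0 < c &
  forall u, op_dom T u -> c * nrm u ^+ 2 <= dot (T u) u.
Proof.
have [c c0 hc] := form_bounded_below h_form; exists c => // u Tu.
have Qu := op_dom_form Tu; rewrite -form_op//.
have := hc u Qu; rewrite lecE normE -rmorphXn => /andP[_].
by rewrite ReZ.
Qed.

End OneForm.

(** The consequence of the form inequality that the gap estimates use, on the
    operator domains. It is one-sided and in real parts, since it is
    applied at one pair [w], [u] with [dot (A w) u = dot (A w) w]. *)
Definition relatively_close (eta : R) (A B : operator V) :=
  forall w u, op_dom A w -> op_dom B u ->
    dot (A w) u - dot w (B u) <= eta * Num.sqrt (dot (A w) w * dot (B u) u).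

(** The form inequality is not visibly symmetric in [h] and [m]; exchanging
    [phi] and [psi] and using the symmetry of the forms gives the other half. *)
Lemma forms_relatively_close (eta : R) (Q : set V) (h m : V -> V -> R[i])
  (H M : operator V) :
  positive_definite_form Q h -> positive_definite_form Q m ->
  operator_of_form ip Q h H -> operator_of_form ip Q m M ->
  (forall phi psi, Q phi -> Q psi -> `|h phi psi - m phi psi|
     <= (eta * Num.sqrt (quadratic h phi * quadratic m psi))%:C) ->
  relatively_close eta H M /\ relatively_close eta M H.
Proof.
move=> h_form m_form H_op M_op hm.
have re_le w u : Q w -> Q u -> `|complex.Re (h w u) - complex.Re (m w u)|
    <= eta * Num.sqrt (quadratic h w * quadratic m u).
  move=> Qw Qu; rewrite -lecR; apply: le_trans (hm _ _ Qw Qu).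
  by apply: le_trans (normc_ge_Re _); rewrite ReD ReN.
split=> w u dw du.
  have Qw := op_dom_form H_op dw; have Qu := op_dom_form M_op du.
  rewrite -(form_op H_op dw Qu) [dot w _]dotC -(form_op M_op du Qw).
  rewrite (form_symmetric_re m_form Qu Qw).
  rewrite -(form_op H_op dw Qw) -(form_op M_op du Qu).
  exact: le_trans (ler_norm _) (re_le _ _ Qw Qu).
have Qw := op_dom_form M_op dw; have Qu := op_dom_form H_op du.
rewrite -(form_op M_op dw Qu) [dot w _]dotC -(form_op H_op du Qw).
rewrite (form_symmetric_re m_form Qw Qu).
rewrite -(form_op M_op dw Qw) -(form_op H_op du Qu) [X in Num.sqrt X]mulrC.
by apply: le_trans (ler_norm _) _; rewrite distrC; exact: re_le.
Qed.

End FormOperators.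

(** * Estimates across a spectral gap *)

Section Gap.
Context (R : realType) (V : completeNormedModType R[i]).
Context (ip : {dot V for (@Num.conj R[i])}) (ip_norm : induces_norm ip).
Local Notation dot := (redot ip).
Context (A B : operator V) (A_sa : selfadjoint ip A) (B_sa : selfadjoint ip B).
Context (EA EB : set R -> {linear V -> V}).
Context (A_sp : spectral_measure ip A EA) (B_sp : spectral_measure ip B EB).
Context (eta : R) (eta_ge0 : 0 <= eta) (AB : relatively_close ip eta A B).
Local Notation pA := (spectral_pvm A_sp).

(** One turn of the contraction: a bound [s] for the projection on the spectral
    subspace improves to [s * q ^+ 2 + eta * q] with [q = b / g]. The bounds of
    the spectra are written as squares to avoid square roots; boundedness of
    [K] puts [w = EA K u] in the domain of [A]. *)
Lemma gap_improve (K S : set R) (b g d s : R) : 0 < b -> 0 < g -> 0 <= s ->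
  measurable K -> measurable S ->
  (forall x, K x -> g ^+ 2 <= x <= d) -> (forall x, S x -> 0 <= x <= b ^+ 2) ->
  (forall u, EB S u = u -> nrm (EA K u) <= s * nrm u) ->
  forall u, EB S u = u ->
    nrm (EA K u) <= (s * (b / g) ^+ 2 + eta * (b / g)) * nrm u.
Proof.
move=> b0 g0 s0 mK mS Kgd Sb IH u Su.
have Bdom : op_dom B u.
  apply: (spectral_dom_bounded ip_norm B_sp (c := b ^+ 2) mS Su) => x.
  by move=> /Sb/andP[x0 xb]; rewrite ger0_norm.
set w := EA K u; have Kw : EA K w = w by exact: (pvm_idem pA).
have Adom : op_dom A w.
  apply: (spectral_dom_bounded ip_norm A_sp (c := d) mK Kw) => x.
  move=> /Kgd/andP[x0 xb]; rewrite ger0_norm//.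
  by apply: le_trans x0; rewrite exprn_ge0// ltW.
have nBu : nrm (B u) <= b ^+ 2 * nrm u.
  have := spectral_nrm_le ip_norm B_sa B_sp mS Su (sqr_ge0 b) Sb.
  by rewrite scale0r !subr0.
have SBu : EB S (B u) = B u.
  by rewrite -(spectral_commute ip_norm B_sa B_sp mS Bdom) Su.
have Bu_le : dot (B u) u <= (b * nrm u) ^+ 2.
  rewrite exprMn; apply: (spectral_form_le ip_norm B_sp mS Su Bdom) => x.
  by move=> /Sb/andP[].
have Aw_ge : (g * nrm w) ^+ 2 <= dot (A w) w.
  rewrite exprMn; apply: (spectral_form_ge ip_norm A_sp mK Kw Adom) => x.
  by move=> /Kgd/andP[].
(* [A w] stays in the range of [EA K], so it only sees the projection [w]
   of [u]. *)
have Awu : dot (A w) u = dot (A w) w.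
  rewrite {3}/w -(pvm_dot pA)//.
  by rewrite -(spectral_commute ip_norm A_sa A_sp mK Adom) Kw.
(* [B u] is again in the range of [EB S], so the bound [s] applies to its
   projection. *)
have wBu : dot w (B u) <= nrm w * (s * (b ^+ 2 * nrm u)).
  rewrite -{1}Kw (pvm_dot pA)//; apply: le_trans (dot_le ip_norm _ _) _.
  rewrite ler_wpM2l ?nrm_ge0// (le_trans (IH _ SBu))//.
  by rewrite ler_wpM2l.
have := AB Adom Bdom; rewrite Awu.
set x := dot (A w) w in Aw_ge *.
have nw := nrm_ge0 w; have nu := nrm_ge0 u.
have x0 : 0 <= x by apply: le_trans Aw_ge; exact: sqr_ge0.
rewrite sqrtrM//.
set p := Num.sqrt x; have p0 : 0 <= p by exact: sqrtr_ge0.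
have gw : g * nrm w <= p.
  by rewrite -ler_sqr ?nnegrE ?mulr_ge0 ?(ltW g0)// sqr_sqrtr.
have sB : Num.sqrt (dot (B u) u) <= b * nrm u.
  have bu0 : 0 <= b * nrm u by rewrite mulr_ge0 ?(ltW b0).
  by rewrite -(ger0_norm bu0) -sqrtr_sqr ler_sqrt// sqr_ge0.
have -> : x = p ^+ 2 by rewrite sqr_sqrtr.
move=> main.
have main2 : p ^+ 2 <= nrm w * (s * (b ^+ 2 * nrm u)) + eta * (p * (b * nrm u)).
  rewrite -lerBlDl (le_trans (lerB (lexx _) wBu))// (le_trans main)//.
  by rewrite !ler_wpM2l.
have main3 : p * (g * p) <= p * (s * b ^+ 2 * nrm u + eta * g * b * nrm u).
  have : g * p ^+ 2
      <= g * (nrm w * (s * (b ^+ 2 * nrm u)) + eta * (p * (b * nrm u))).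
    by rewrite ler_pM2l.
  have : (g * nrm w) * (s * b ^+ 2 * nrm u) <= p * (s * b ^+ 2 * nrm u).
    by rewrite ler_wpM2r// !mulr_ge0// ltW.
  lra.
have [p_eq0|p_neq0] := eqVneq p 0.
  have -> : nrm w = 0.
    by apply/eqP; move: gw; rewrite p_eq0 pmulr_rle0// eq_le nw => ->.
  have [b_ge0 gi_ge0] : 0 <= b /\ 0 <= g^-1 by rewrite invr_ge0 !ltW.
  by rewrite !(mulr_ge0, addr_ge0).
have {}p_gt0 : 0 < p by rewrite lt_neqAle eq_sym p_neq0.
move: main3; rewrite (ler_pM2l p_gt0) => main4.
rewrite -(ler_pM2l (exprn_gt0 2 g0)).
have -> : g ^+ 2 * ((s * (b / g) ^+ 2 + eta * (b / g)) * nrm u)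
    = s * b ^+ 2 * nrm u + eta * g * b * nrm u by field; rewrite gt_eqF.
apply: le_trans main4; rewrite expr2 -mulrA ler_wpM2l// ltW//.
Qed.

(** The infimum of the admissible bounds is admissible, and [gap_improve]
    applied to it gives [inf C <= inf C * q ^+ 2 + eta * q], where
    [q ^+ 2 = b / g < 1]. *)
Lemma gap_estimate (S : set R) (b g d : R) : 0 < b -> b < g ->
  measurable S -> (forall x, S x -> 0 <= x <= b) ->
  forall u, EB S u = u ->
    nrm (EA [set` `[g, d]] u) <= Num.sqrt (g * b) / (g - b) * eta * nrm u.
Proof.
move=> b0 bg mS Sb u Su; have g0 := lt_trans b0 bg.
have mK : measurable [set` `[g, d]] by exact: measurable_itv.
set K := [set` _] in mK *.
pose q := Num.sqrt b / Num.sqrt g.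
have sb0 : 0 < Num.sqrt b by rewrite sqrtr_gt0.
have sg0 : 0 < Num.sqrt g by rewrite sqrtr_gt0.
have q0 : 0 < q by rewrite divr_gt0.
have q2 : q ^+ 2 = b / g by rewrite /q expr_div_n !sqr_sqrtr ?ltW.
have q2_lt1 : q ^+ 2 < 1 by rewrite q2 ltr_pdivrMr// mul1r.
pose C := [set s : R | 0 <= s /\
  forall v, EB S v = v -> nrm (EA K v) <= s * nrm v].
have C1 : C 1.
  by split => // v _; rewrite mul1r (pvm_nrm ip_norm pA).
have lbC : lbound C 0 by move=> s [].
have infC : has_inf C by split; [exists 1|exists 0].
have inf0 : 0 <= inf C by apply: lb_le_inf => //; exists 1.
have Cinf : C (inf C).
  split => // v Sv; have [v0|v_neq0] := eqVneq (nrm v) 0.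
    by rewrite v0 mulr0; have := pvm_nrm ip_norm pA v mK; rewrite v0.
  have v_gt0 : 0 < nrm v by rewrite lt_neqAle eq_sym v_neq0 nrm_ge0.
  rewrite -ler_pdivrMr//; apply: lb_le_inf; first by exists 1.
  by move=> s [_ sv]; rewrite ler_pdivrMr// sv.
have [_ Cstep] := Cinf.
have {}Cstep := gap_improve sb0 sg0 inf0 mK mS _ _ Cstep.
have inf_le : inf C <= inf C * q ^+ 2 + eta * q.
  apply: ge_inf; first by exists 0.
  split; first by rewrite addr_ge0 ?mulr_ge0// ?sqr_ge0// ltW.
  apply: (Cstep d) => x; rewrite sqr_sqrtr ?(ltW g0) ?(ltW b0)//.
  exact: Sb.
have -> : Num.sqrt (g * b) / (g - b) * eta = eta * q / (1 - q ^+ 2).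
  rewrite q2 /q sqrtrM ?ltW//; set sg := Num.sqrt g; set sb := Num.sqrt b.
  have gE : g = sg ^+ 2 by rewrite sqr_sqrtr ?ltW.
  have bE : b = sb ^+ 2 by rewrite sqr_sqrtr ?ltW.
  have gb : sg ^+ 2 - sb ^+ 2 != 0 by rewrite -gE -bE subr_eq0 gt_eqF.
  have -> : g - b = sg ^+ 2 - sb ^+ 2 by rewrite -gE -bE.
  have -> : b / g = sb ^+ 2 / sg ^+ 2 by rewrite -gE -bE.
  field; rewrite gb gt_eqF//=.
have : inf C <= eta * q / (1 - q ^+ 2) by rewrite ler_pdivlMr ?subr_gt0//; lra.
move=> /(ler_wpM2r (nrm_ge0 u)); apply: le_trans.
by case: Cinf => _; apply.
Qed.

Lemma gap_estimate_infty (S : set R) (b g : R) : 0 < b -> b < g ->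
  measurable S -> (forall x, S x -> 0 <= x <= b) ->
  forall u, EB S u = u ->
    nrm (EA [set` `[g, +oo[] u) <= Num.sqrt (g * b) / (g - b) * eta * nrm u.
Proof.
move=> b0 bg mS Sb u Su; apply: (pvm_nrm_limit ip_norm pA).
  by rewrite !mulr_ge0 ?nrm_ge0 ?sqrtr_ge0// invr_ge0 subr_ge0 ltW.
by move=> d _; exact: gap_estimate Su.
Qed.

End Gap.

(** * The spectral window *)

Section Window.
Context (R : realType) (V : completeNormedModType R[i]).
Context (ip : {dot V for (@Num.conj R[i])}) (ip_norm : induces_norm ip).
Local Notation dot := (redot ip).
Context (H M : operator V) (H_sa : selfadjoint ip H) (M_sa : selfadjoint ip M).
Context (EH EM : set R -> {linear V -> V}).
Context (H_sp : spectral_measure ip H EH) (M_sp : spectral_measure ip M EM).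
Context (eta : R) (eta_ge0 : 0 <= eta).
Context (HM : relatively_close ip eta H M) (MH : relatively_close ip eta M H).
Context (c : R) (c_gt0 : 0 < c)
  (H_ge : forall u, op_dom H u -> c * nrm u ^+ 2 <= dot (H u) u).
Context (L1 L2 D1 D2 : R) (L1_gt0 : 0 < L1) (L1L2 : L1 < L2) (L2D1 : L2 < D1)
  (D1D2 : D1 < D2).
Context (LH : forall x : R, L1 <= x <= L2 -> resolvent_set H x%:C)
  (DH : forall x : R, D1 <= x <= D2 -> resolvent_set H x%:C).
Local Notation pH := (spectral_pvm H_sp).
Local Notation pM := (spectral_pvm M_sp).
Local Notation I := [set` `[L2, D1]].

(** Outside the window only [(0, L1]] and [[D2, oo)] carry spectrum of [H]. The
    upper part is bounded by a gap estimate with [H] above [M]; for the lower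
    part [H] is below [M], so the gap estimate bounds the adjoint: the
    projection by [EM] of vectors in the range of [EH] of [(0, L1]]. *)
Lemma window_complement_le u : EM I u = u ->
  nrm (EH (~` I) u) <= (Num.sqrt (D2 * D1) / (D2 - D1)
         + Num.sqrt (L2 * L1) / (L2 - L1)) * eta * nrm u.
Proof.
move=> Iu; have L1D2 : L1 < D2 := lt_trans L1L2 (lt_trans L2D1 D1D2).
have L2_gt0 : 0 < L2 := lt_trans L1_gt0 L1L2.
have D1_gt0 : 0 < D1 := lt_trans L2_gt0 L2D1.
have mI : measurable I by exact: measurable_itv.
pose lo : set R := [set` `]0, L1]]; pose hi : set R := [set` `[D2, +oo[].
have mlo : measurable lo by exact: measurable_itv.
have mhi : measurable hi by exact: measurable_itv.
pose N := [set` `]-oo, (0 : R)]] `|` ([set` `[L1, L2]] `|` [set` `[D1, D2]]).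
have m0 : measurable [set` `]-oo, (0 : R)]] by exact: measurable_itv.
have mL : measurable [set` `[L1, L2]] by exact: measurable_itv.
have mD : measurable [set` `[D1, D2]] by exact: measurable_itv.
have mN : measurable N by apply: measurableU => //; exact: measurableU.
have N0 : pvm_null EH N.
  apply: (pvm_nullU pH) => //; first exact: measurableU.
    exact: (pvm_null_nonpositive ip_norm H_sa H_sp c_gt0 H_ge).
  by apply: (pvm_nullU pH) => //;
    apply: (pvm_null_resolvent ip_norm H_sa H_sp) => //; exact: ltW.
rewrite (pvm_null_eq pH (A := lo `|` hi) (N := N))//.
- rewrite (pvmU pH)//; last first.
    apply/seteqP; split => // x []; rewrite /lo /hi/= !in_itv/=.
    move=> /andP[_ xL] /andP[xD _].
    by have := le_trans xD xL; rewrite leNgt L1D2.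
  apply: le_trans (nrmD _ _) _; rewrite addrC 2!mulrDl lerD//.
    apply: (gap_estimate_infty ip_norm H_sa M_sa H_sp M_sp eta_ge0 HM
      _ _ mI _ Iu) => // x.
    by rewrite /= in_itv/= => /andP[Lx ->]; rewrite (le_trans (ltW L2_gt0)).
  set y := EH lo u.
  have loy : EH lo y = y by exact: (pvm_idem pH).
  have Py : nrm (EM I y) <= Num.sqrt (L2 * L1) / (L2 - L1) * eta * nrm y.
    apply: (gap_estimate ip_norm M_sa H_sa M_sp H_sp eta_ge0 MH D1
      _ _ mlo _ loy) => // x.
    by rewrite /lo/= in_itv/= => /andP[/ltW-> ->].
  apply: (nrm_le_of_sqr ip_norm).
    by rewrite !mulr_ge0 ?nrm_ge0 ?sqrtr_ge0// invr_ge0 subr_ge0 ltW.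
  have -> : dot y y = dot (EM I y) u.
    by rewrite (pvm_dot pM)// Iu {2}/y -(pvm_dot pH)// loy.
  apply: le_trans (dot_le ip_norm _ _) _.
  by rewrite mulrAC ler_wpM2r ?nrm_ge0.
- exact: measurableU.
- exact: measurableC.
- move=> x xlh; apply/negP; rewrite in_itv/= negb_and -!ltNge; apply/orP.
  case: xlh; rewrite /lo /hi/= in_itv/= => /andP[x1 x2].
    by left; exact: le_lt_trans L1L2.
  by right; exact: lt_le_trans x1.
- move=> x /= /negP; rewrite in_itv/= negb_and -!ltNge => xI.
  have [x0|x0] := leP x 0; first by right; left; rewrite /= in_itv.
  case/orP: xI => xI.
    have [xL|xL] := leP x L1; first by left; left; rewrite /lo/= in_itv/= x0.
    by right; right; left; rewrite /= in_itv/= !ltW.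
  have [xD|xD] := leP D2 x; first by left; right; rewrite /hi/= in_itv/= xD.
  by right; right; right; rewrite /= in_itv/= !ltW.
Qed.

End Window.

Section ProjectionDifference.
Context (R : realType) (V : completeNormedModType R[i]).
Context (ip : {dot V for (@Num.conj R[i])}) (ip_norm : induces_norm ip).
Local Notation dot := (redot ip).

(** With [a = P u - Q (P u)] and [b = Q (u - P u)] one has [P u - Q u = a - b],
    where [a] and [b] are orthogonal, and so are [P u] and [u - P u], whose
    squared norms sum to [nrm u ^+ 2]. *)
Lemma opnorm_projection_sub (P Q : {linear V -> V}) (c : R) :
  orthogonal_projection ip P -> orthogonal_projection ip Q -> 0 <= c ->
  (forall u, P u = u -> nrm (u - Q u) <= c * nrm u) ->
  (forall u, Q u = u -> nrm (u - P u) <= c * nrm u) ->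
  (opnorm (P \- Q)%R <= c%:E)%E.
Proof.
move=> pP pQ c0 PQ QP; apply: ge_ereal_sup => _ [u /= u1 <-].
rewrite lee_fin -/(nrm _).
have {}u1 : nrm u <= 1 by rewrite -lecR -normE.
have dP v w : dot (P v) w = dot v (P w) by exact: proj_dot.
have dQ v w : dot (Q v) w = dot v (Q w) by exact: proj_dot.
have PP v : P (P v) = P v by case: pP.
have QQ v : Q (Q v) = Q v by case: pQ.
pose a := P u - Q (P u); pose b := Q (u - P u).
have -> : (P u - Q u)%R = a - b.
  by rewrite /a /b linearB/= opprB addrA subrK.
have Qa : Q a = 0 by rewrite /a linearB/= QQ subrr.
have ab : dot a b = 0 by rewrite /b -dQ Qa dot0l.
have nab := pythagoras ip_norm ab.
have nu : nrm u ^+ 2 = nrm (P u) ^+ 2 + nrm (u - P u) ^+ 2.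
  rewrite !(sqr_nrm ip_norm) !(dotBl, dotBr) !dP PP.
  by rewrite -dP; ring.
have na : nrm a <= c * nrm (P u) by apply: PQ.
have nb : nrm b <= c * nrm (u - P u).
  apply: (nrm_le_of_sqr ip_norm); first by rewrite mulr_ge0// nrm_ge0.
  (* [Q (1 - P)] is the adjoint of [(1 - P) Q], which [QP] bounds. *)
  have Qb : Q b = b by rewrite /b QQ.
  have -> : dot b b = dot (b - P b) (u - P u).
    rewrite [RHS]dotBl dP [P (u - _)]linearB/= PP subrr [dot b 0]dotC dot0l.
    by rewrite subr0 {2}/b -dQ Qb.
  apply: le_trans (dot_le ip_norm _ _) _; rewrite mulrAC.
  by rewrite ler_wpM2r ?nrm_ge0// QP.
rewrite -ler_sqr ?nnegrE ?nrm_ge0// nab.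
apply: (@le_trans _ _ (c ^+ 2 * nrm u ^+ 2)).
  rewrite nu mulrDr -!exprMn.
  by rewrite lerD// lerXn2r// ?nnegrE ?mulr_ge0 ?nrm_ge0.
by rewrite ler_piMr ?sqr_ge0// exprn_ile1 ?nrm_ge0.
Qed.

End ProjectionDifference.

Theorem theorem3p3 (R : realType) (V : completeNormedModType R[i])
  (ip : {dot V for (@Num.conj R[i])}) (ip_norm : induces_norm ip)
  (Q : set V) (h m : V -> V -> R[i])
  (h_form : positive_definite_form Q h) (m_form : positive_definite_form Q m)
  (H M : operator V)
  (H_op : operator_of_form ip Q h H) (M_op : operator_of_form ip Q m M)
  (EH EM : set R -> {linear V -> V})
  (EH_spec : spectral_measure ip H EH) (EM_spec : spectral_measure ip M EM)
  (eta : R) (eta_ge0 : 0 <= eta)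
  (hm : forall phi psi : V, Q phi -> Q psi ->
    `|h phi psi - m phi psi|
      <= (eta * Num.sqrt (quadratic h phi * quadratic m psi))%:C)
  (L1 L2 D1 D2 : R)
  (L1_gt0 : 0 < L1) (L1L2 : L1 < L2) (L2D1 : L2 < D1) (D1D2 : D1 < D2)
  (LH : forall x : R, L1 <= x <= L2 -> resolvent_set H x%:C)
  (LM : forall x : R, L1 <= x <= L2 -> resolvent_set M x%:C)
  (DH : forall x : R, D1 <= x <= D2 -> resolvent_set H x%:C)
  (DM : forall x : R, D1 <= x <= D2 -> resolvent_set M x%:C)
  (small : (Num.sqrt (D2 * D1) / (D2 - D1)
            + Num.sqrt (L2 * L1) / (L2 - L1)) * eta < 1) :
  (opnorm (EM [set` `[L2, D1]] \- EH [set` `[L2, D1]])%R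
    <= ((Num.sqrt (D2 * D1) / (D2 - D1)
         + Num.sqrt (L2 * L1) / (L2 - L1)) * eta)%:E)%E.
Proof.
have pH := spectral_pvm EH_spec; have pM := spectral_pvm EM_spec.
have [HM MH] := forms_relatively_close h_form m_form H_op M_op hm.
have [cH cH_gt0 H_ge] := form_op_bounded_below h_form H_op.
have [cM cM_gt0 M_ge] := form_op_bounded_below m_form M_op.
have mI : measurable [set` `[L2, D1]] by exact: measurable_itv.
apply: (opnorm_projection_sub ip_norm).
- exact: (pvm_proj pM).
- exact: (pvm_proj pH).
- by rewrite mulr_ge0// addr_ge0// mulr_ge0 ?sqrtr_ge0// invr_ge0 subr_ge0 ltW.
- move=> u Pu; rewrite {1}(pvmC pH u mI) addrAC subrr add0r.
  by apply: (window_complement_le ip_norm H_op.1 M_op.1 EH_spec EM_spec _ HM MH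
    cH_gt0 H_ge) Pu.
- move=> u Qu; rewrite {1}(pvmC pM u mI) addrAC subrr add0r.
  by apply: (window_complement_le ip_norm M_op.1 H_op.1 EM_spec EH_spec _ MH HM
    cM_gt0 M_ge) Qu.
Qed.
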